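(* Let $G$ be a finite simple $2$-edge connected graph and let $k \geq 3$ be an integer. If the degree of every vertex of $G$ is divisible by $k$, then every edge of $G$ is contained in a circuit of even length.
   Context: Graphs are finite, simple (no loops, no multiple edges). A graph is $2$-edge connected if it is connected and remains connected whenever fewer than $2$ edges are removed. A walk is a sequence $v_0, e_1, v_1, \ldots, e_k, v_k$ of vertices and edges with $e_i$ having endpoints $v_{i-1}, v_i$; a trail is a walk with no repeated edge; a circuit is a trail whose first and last vertices coincide (vertices may repeat). The length of a circuit is its number of edges. *)

(* Defs.v *)
From mathcomp Require Import all_boot.

Set Implicit Arguments.
Unset Strict Implicit.
Unset Printing Implicit Defensive.

(* A finite simple graph is a symmetric irreflexive relation [adj] on a finType
   of vertices; an edge is the unordered pair [set u; v] of its endpoints. *)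

Definition simple_graph (V : finType) (adj : rel V) : Prop :=
  symmetric adj /\ irreflexive adj.

Definition edges (V : finType) (adj : rel V) : {set {set V}} :=
  [set f : {set V} | [exists u, exists v, adj u v && (f == [set u; v])]].

Definition degree (V : finType) (adj : rel V) (v : V) : nat :=
  #|[set w | adj v w]|.

Definition remove_edges (V : finType) (adj : rel V) (F : {set {set V}}) :
  rel V := [rel u v | adj u v && ([set u; v] \notin F)].

Definition connected (V : finType) (adj : rel V) : Prop :=
  forall u v : V, connect adj u v.

Definition edge_connected (V : finType) (l : nat) (adj : rel V) : Prop :=
  connected adj /\
  forall F : {set {set V}},
    F \subset edges adj -> #|F| < l -> connected (remove_edges adj F).

(* A walk v_0, e_1, v_1, ..., e_n, v_n is given by its first vertex x = v_0 and
   the sequence p = [:: v_1; ...; v_n]: since the graph is simple, its edges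
   are determined by e_i = {v_(i-1), v_i}. *)

Definition walk (V : finType) (adj : rel V) (x : V) (p : seq V) : bool :=
  path adj x p.

Definition walk_edges (V : finType) (x : V) (p : seq V) : seq {set V} :=
  pairmap (fun u v => [set u; v]) x p.

Definition trail (V : finType) (adj : rel V) (x : V) (p : seq V) : bool :=
  walk adj x p && uniq (walk_edges x p).

Definition circuit (V : finType) (adj : rel V) (x : V) (p : seq V) : bool :=
  trail adj x p && (last x p == x).

Definition walk_length (V : finType) (x : V) (p : seq V) : nat :=
  size (walk_edges x p).

(* Main.v *)
Require Import Defs.
From mathcomp Require Import all_boot.

(* Let f = {u, v} and H = G - f. An odd trail of H from u to v closes up with f
   to an even circuit, so suppose that there is none.
   If H has an odd closed walk, it has an odd circuit D. Since G is 2-edge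
   connected, every vertex lies on some trail of H from u to v; take one that
   meets D. Follow it from u and from v until it first meets D, and join the two
   ends along either of the two arcs of D: one of the resulting trails is odd.
   Otherwise H is bipartite, with u and v on the same side because a path from u
   to v is even. Then the degree sums (in G) of the two sides differ by 2, while
   both are divisible by k >= 3. *)

(** * Walks and their edge sequences *)

Section Walks.
Set Implicit Arguments.
Unset Strict Implicit.
Unset Printing Implicit Defensive.

Variable V : finType.
Implicit Types (e : rel V) (x y a b : V) (p q : seq V).

Lemma walk_edges_cat x p q :
  walk_edges x (p ++ q) = walk_edges x p ++ walk_edges (last x p) q.
Proof. exact: pairmap_cat. Qed.

Lemma size_walk_edges x p : size (walk_edges x p) = size p.
Proof. exact: size_pairmap. Qed.

Lemma last_rev_belast x p : last (last x p) (rev (belast x p)) = x.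
Proof. by case: p => //= y p; rewrite rev_cons last_rcons. Qed.

Lemma walk_edges_rev x p :
  walk_edges (last x p) (rev (belast x p)) = rev (walk_edges x p).
Proof.
elim: p x => [|y p IHp] x //=.
rewrite !rev_cons -cats1 walk_edges_cat IHp -cats1; congr (_ ++ _).
by rewrite last_rev_belast /= setUC.
Qed.

Lemma walk_edges_sub x p E : E \in walk_edges x p -> E \subset x :: p.
Proof.
elim: p x => //= y p IHp x; rewrite inE => /orP[/eqP->|/IHp sEp].
  by apply/subsetP=> z; rewrite !inE => /orP[]->; rewrite ?orbT.
by apply/subsetP=> z /(subsetP sEp) zp; rewrite inE zp orbT.
Qed.

(** The first edge contains [x], which no later edge does. *)
Lemma uniq_walk_edges x p : uniq (x :: p) -> uniq (walk_edges x p).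
Proof.
elim: p x => //= y p IHp x /andP[xNp up]; rewrite IHp // andbT.
apply/negP => /walk_edges_sub/subsetP/(_ x).
by rewrite set21 (negPf xNp) => /(_ isT).
Qed.

Lemma path_remove_edges e (F : {set {set V}}) x p :
  path (remove_edges e F) x p =
  path e x p && all (fun E => E \notin F) (walk_edges x p).
Proof. by elim: p x => //= y p IHp x; rewrite IHp andbACA. Qed.

(** The walk is cut at its first vertex in [D]. Each edge before the cut starts outside [D], so by
    [walk_edges_sub] it cannot belong to a walk that stays in [D]; edge-disjointness is obtained
    from this below. *)
Lemma first_hit (D : {pred V}) x p :
  has [in D] (x :: p) ->
  exists p1 p2, [/\ p = p1 ++ p2, last x p1 \in D &
    forall E, E \in walk_edges x p1 -> ~~ (E \subset D)].
Proof.
elim: p x => [|y p IHp] x.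
  by rewrite /= orbF => xD; exists [::], [::].
have [xD _|xND] := boolP (x \in D); first by exists [::], (y :: p).
rewrite /= (negPf xND) => /IHp[p1 [p2 [-> p1D offD]]].
exists (y :: p1), p2; split=> // E; rewrite inE => /orP[/eqP->|/offD//].
by apply: contra xND => /subsetP; apply; rewrite set21.
Qed.

(** * Trails with prescribed ends: splitting, joining, reversing, rerouting *)

Definition trail_to e x y p := trail e x p && (last x p == y).

Lemma trail_to_cat e x y p q :
  trail_to e x y (p ++ q) =
  [&& trail_to e x (last x p) p, trail_to e (last x p) y q &
      ~~ has [in walk_edges x p] (walk_edges (last x p) q)].
Proof.
rewrite /trail_to /trail /walk cat_path walk_edges_cat cat_uniq last_cat eqxx.
rewrite andbT -!andbA; case: (path e x p) => //=.
case: (path _ _ q); rewrite ?andbF //=; case: (uniq _) => //=.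
by case: (has _ _) => /=; rewrite ?andbF ?andbT // andbC.
Qed.

Lemma trail_to_catI e x y z p q :
  trail_to e x y p -> trail_to e y z q ->
  {in walk_edges y q, forall E, E \notin walk_edges x p} ->
  trail_to e x z (p ++ q).
Proof.
move=> tp tq dis; have /eqP py : last x p == y by case/andP: tp.
by rewrite trail_to_cat py tp tq; apply/hasPn.
Qed.

Lemma trail_to_split e x y z p :
  trail_to e x y p -> z \in x :: p ->
  exists p1 p2, [/\ p = p1 ++ p2, trail_to e x z p1, trail_to e z y p2 &
    {in walk_edges z p2, forall E, E \notin walk_edges x p1}].
Proof.
move=> tp zp; move: tp; case/splitPl: zp => p1 p2 p1z.
rewrite trail_to_cat p1z => /and3P[t1 t2 /hasPn dis].
by exists p1, p2.
Qed.

Lemma trail_to_rev e x y p : symmetric e ->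
  trail_to e x y p -> trail_to e y x (rev (belast x p)).
Proof.
move=> e_sym /andP[/andP[pp up] /eqP<-].
rewrite /trail_to /trail /walk walk_edges_rev rev_uniq up last_rev_belast eqxx.
by rewrite rev_path (eq_path (e' := e)) ?[path _ _ _]pp // => a b.
Qed.

Lemma walk_edges_trail_rev e x y p : trail_to e x y p ->
  walk_edges y (rev (belast x p)) =i walk_edges x p.
Proof.
by move=> /andP[_ /eqP<-] E; rewrite walk_edges_rev mem_rev.
Qed.

Lemma connect_trail e x y : connect e x y -> exists p, trail_to e x y p.
Proof.
case/connectP=> p /shortenP[q pq uq _] ->; exists q.
by rewrite /trail_to /trail /walk pq uniq_walk_edges /=.
Qed.

(** [q] is an ear, edge-disjoint from the trail and attached to it at [a] and [b]; it replaces a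
    stretch of the trail between them. *)
Lemma trail_reroute e x y a b p q : symmetric e ->
  trail_to e x y p -> a \in x :: p -> b \in x :: p -> trail_to e a b q ->
  {in walk_edges a q, forall E, E \notin walk_edges x p} ->
  exists2 p', trail_to e x y p' & {subset a :: q <= x :: p'}.
Proof.
move=> e_sym tp ap bp tq dis.
have [p1 [p2 [def_p t1 t2 dis12]]] := trail_to_split tp ap.
have /eqP p1a : last x p1 == a by case/andP: t1.
have /eqP qb : last a q == b by case/andP: tq.
have dis1 E : E \in walk_edges a q -> E \notin walk_edges x p1.
  by move=> /dis; rewrite def_p walk_edges_cat mem_cat negb_or => /andP[].
have dis2 E : E \in walk_edges a q -> E \notin walk_edges a p2.
  by move=> /dis; rewrite def_p walk_edges_cat mem_cat negb_or p1a => /andP[].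
(* If [b] occurs before [a], the ear is traversed backwards. *)
have [bp1|bNp1] := boolP (b \in x :: p1).
  have [p3 [p4 [def_p1 t3 _ _]]] := trail_to_split t1 bp1.
  have /eqP p3b : last x p3 == b by case/andP: t3.
  have tr := trail_to_rev e_sym tq.
  exists (p3 ++ rev (belast a q) ++ p2).
    apply: trail_to_catI t3 _ _.
      apply: trail_to_catI tr t2 _ => E Ep2.
      by rewrite (walk_edges_trail_rev tq); apply: contraL Ep2 => /dis2.
    have /eqP qa : last b (rev (belast a q)) == a by case/andP: tr.
    move=> E; rewrite walk_edges_cat mem_cat (walk_edges_trail_rev tq) qa.
    move=> /orP[/dis1|/dis12];
      by rewrite def_p1 walk_edges_cat mem_cat negb_or => /andP[].
  move=> z; rewrite lastI mem_rcons qb inE -cat_cons !mem_cat mem_rev.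
  move=> /orP[/eqP->|->]; last by rewrite orbT.
  by rewrite -p3b mem_last.
have bp2 : b \in a :: p2.
  move: bp bNp1; rewrite def_p -cat_cons mem_cat => /orP[->//|bp2] _.
  by rewrite inE bp2 orbT.
have [p3 [p4 [def_p2 t3 t4 _]]] := trail_to_split t2 bp2.
have /eqP p3b : last a p3 == b by case/andP: t3.
exists (p1 ++ q ++ p4).
  apply: trail_to_catI t1 _ _.
    apply: trail_to_catI tq t4 _ => E Ep4; apply/negP => /dis2.
    by rewrite def_p2 walk_edges_cat mem_cat p3b Ep4 orbT.
  move=> E; rewrite walk_edges_cat mem_cat qb => /orP[/dis1//|Ep4].
  by apply: dis12; rewrite def_p2 walk_edges_cat mem_cat p3b Ep4 orbT.
move=> z; rewrite inE -cat_cons !mem_cat => /orP[/eqP->|->].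
  by rewrite -p1a mem_last.
by rewrite orbT.
Qed.

(** * Odd closed walks, odd circuits and two-colourings *)

Lemma odd_closed_walk_circuit e x p :
  path e x p -> last x p = x -> odd (size p) ->
  exists y q, trail_to e y y q /\ odd (size q).
Proof.
(* Induction on the length: a repeated vertex splits the closed walk into two shorter closed walks,
   one of which is odd. *)
have [n] := ubnP (size p); elim: n x p => // n IHn x p.
rewrite ltnS => szp pp px op.
(* Repetitions are sought in [p], not in [x :: p], since [x] recurs as the last vertex. *)
have [up|/(uniqPn x)[i [j [ltij ltj eqij]]]] := boolP (uniq p); last first.
  pose y := nth x p i; pose q1 := take i.+1 p.
  pose q2 := drop i.+1 (take j.+1 p); pose q3 := drop j.+1 p.
  have def_q12 : take j.+1 p = q1 ++ q2.
    by rewrite -[LHS](cat_take_drop i.+1) take_takel // ltnS ltnW.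
  have def_p : p = q1 ++ q2 ++ q3.
    by rewrite catA -def_q12 cat_take_drop.
  have q1y : last x q1 = y.
    by rewrite /q1 (take_nth x) ?(ltn_trans ltij) // last_rcons.
  have q2y : last y q2 = y.
    by rewrite -q1y -last_cat -def_q12 (take_nth x) // last_rcons -eqij q1y.
  move: pp px op szp; rewrite def_p !cat_path !last_cat q1y q2y.
  move=> /and3P[pq1 pq2 pq3] q3x; rewrite !size_cat !oddD => op szp.
  have sz1 : 0 < size q1 by rewrite size_takel // (ltn_trans ltij).
  have sz2 : 0 < size q2 by rewrite size_drop size_takel // subn_gt0.
  have [o2|e2] := boolP (odd (size q2)).
    apply: (IHn y q2) => //; apply: leq_trans szp.
    by rewrite -add1n leq_add // leq_addr.
  apply: (IHn x (q1 ++ q3)).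
  - by apply: leq_trans szp; rewrite size_cat ltn_add2l -add1n leq_add2r.
  - by rewrite cat_path q1y pq1.
  - by rewrite last_cat q1y.
  by rewrite size_cat oddD; move: op; rewrite (negPf e2).
exists x, p; split=> //; rewrite /trail_to /trail /walk pp px eqxx andbT /=.
move: pp px up op; case/lastP: p {szp} => // q z.
rewrite last_rcons => + zx; rewrite {z}zx rcons_path rcons_uniq size_rcons.
move=> /andP[pq eqx] /andP[xNq uq] oq.
rewrite -cats1 walk_edges_cat cats1 rcons_uniq.
rewrite uniq_walk_edges ?andbT /= ?xNq //.
(* Length 2 would traverse one edge twice, but parity excludes it. From length 3 on, the closing
   edge differs from the first one, as [last z q] is neither [x] nor [y], and from the later ones,
   which avoid [x]. *)
case: q pq eqx xNq uq oq => [|y [|z q]] //=.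
move=> _ _ xNq /andP[yNq _] _; rewrite inE negb_or; apply/andP; split.
  apply/negP => /eqP/setP/(_ (last z q)).
  rewrite !inE eqxx /=; have lq : last z q \in z :: q by rewrite mem_last.
  case: eqP lq xNq => [->|_]; first by rewrite !inE => ->; rewrite orbT.
  by case: eqP yNq => // -> /negPf->.
apply/negP; have := @walk_edges_sub y (z :: q) [set last z q; x].
move=> /[apply] /subsetP/(_ x); rewrite set22 => /(_ isT).
by apply/negP.
Qed.

(* [cover] is the bipartite double cover: [e] is two-colourable unless the two
   lifts of some vertex are connected in it. *)
Lemma odd_closed_walk_or_coloring e : symmetric e -> connected e ->
  (exists x p, [/\ path e x p, last x p = x & odd (size p)]) \/
  (exists c : pred V, forall x y, e x y -> c x != c y).
Proof.
move=> e_sym econ.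
pose cover : rel (V * bool) := [rel s t | e s.1 t.1 && (s.2 != t.2)].
have lift x p i : path e x p -> exists j, connect cover (x, i) (last x p, j).
  elim: p x i => [|y p IHp] x i /=; first by exists i; apply: connect0.
  case/andP=> exy /(IHp _ (~~ i))[j yj]; exists j.
  apply: connect_trans yj; apply: connect1.
  by rewrite /cover /= exy; case: i.
have proj s (p : seq (V * bool)) : path cover s p ->
    path e s.1 (map fst p) /\ (last s p).2 = s.2 (+) odd (size p).
  elim: p s => [|t p IHp] s /=; first by rewrite addbF.
  case/andP=> /andP[est nst] /IHp[-> ->]; rewrite est; split=> //.
  by move: nst; case: s.2; case: t.2 => //=; case: (odd _).
have csym : connect_sym cover.
  by apply: sym_connect_sym => s t; rewrite /cover /= e_sym eq_sym.
(* A path in [cover] between the two lifts of [x] flips the bit an odd number of times, hence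
   projects to an odd closed walk. *)
have [/existsP[x /connectP[p pp lp]]|] :=
  boolP [exists x, connect cover (x, false) (x, true)].
  have [pe] := proj _ _ pp; rewrite -lp /= => op.
  left; exists x, (map fst p); split=> //; last by rewrite size_map -op.
  by rewrite (last_map fst p (x, false)) -lp.
rewrite negb_exists => /forallP sep; right.
have [r _|noV] := pickP (predT : pred V); last first.
  by exists predT => x; have := noV x.
(* Connectedness of [e] puts at least one lift of each vertex into the component of [(r, false)],
   and [sep] at most one; the bit of that lift is the colour. *)
exists (fun x => connect cover (r, false) (x, true)) => x y exy.
have both z : connect cover (r, false) (z, true) ->
    connect cover (r, false) (z, false) -> False.
  move=> c1 c0; case/negP: (sep z); apply: connect_trans c1.
  by rewrite csym.
have step i : connect cover (r, false) (x, i) ->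
    connect cover (r, false) (y, ~~ i).
  move=> /connect_trans; apply; apply: connect1.
  by rewrite /cover /= exy; case: i.
have [p pp lp] := connectP (econ r x).
have [[] rx] := lift r p false pp; rewrite -lp in rx.
  by rewrite rx; apply/negP => /eqP/esym/both; apply; apply: step rx.
have -> : connect cover (r, false) (y, true) by apply: step rx.
by apply/negP => /eqP /both; apply.
Qed.

Lemma coloring_walk e (c : pred V) x p :
  (forall y z, e y z -> c y != c z) ->
  path e x p -> c (last x p) = c x (+) odd (size p).
Proof.
move=> col; elim: p x => [|y p IHp] x /=; first by rewrite addbF.
case/andP=> /col cxy /IHp->.
by move: cxy; case: (c x); case: (c y) => //=; case: (odd _).
Qed.

End Walks.

(** * The graph without the edge uv: its trails from [u] to [v] and its two-colourings *)

Section EdgeInTwoEdgeConnected.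
Set Implicit Arguments.
Unset Strict Implicit.
Unset Printing Implicit Defensive.

Variables (V : finType) (adj : rel V) (u v : V).
Hypotheses (adj_simple : simple_graph adj) (adj_2con : edge_connected 2 adj).
Hypothesis adj_uv : adj u v.

Let H := remove_edges adj [set [set u; v]].

Lemma remove_edge_connected x y :
  adj x y -> connected (remove_edges adj [set [set x; y]]).
Proof.
move=> exy; apply: (proj2 adj_2con); last by rewrite cards1.
rewrite sub1set inE; apply/existsP; exists x; apply/existsP; exists y.
by rewrite exy eqxx.
Qed.

Lemma remove_edge_sym x y : symmetric (remove_edges adj [set [set x; y]]).
Proof. by move=> a b; rewrite /remove_edges /= (proj1 adj_simple) setUC. Qed.

(** Induction along a path of [H] from [u]: if the next vertex [y] is not on the current trail
    through [x'], the edge from [x'] to [y] starts an ear that returns to the trail, and the trail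
    is rerouted over it. *)
Lemma trail_through x : exists2 p, trail_to H u v p & x \in u :: p.
Proof.
have Hsym : symmetric H := remove_edge_sym u v.
have /connectP[q qH ->] : connect H u x := remove_edge_connected adj_uv u x.
elim/last_ind: q qH => [_|q y IHq].
  have [p tp] := connect_trail (remove_edge_connected adj_uv u v).
  by exists p; rewrite // mem_head.
rewrite rcons_path last_rcons => /andP[/IHq{IHq}[p tp]].
move: (last u q) => {q}x' x'p Hxy.
have [yp|yNp] := boolP (y \in u :: p); first by exists p.
have exy : adj x' y by case/andP: Hxy.
(* The way back is sought in [adj] without the edge x'y: deleting uv as well could disconnect the
   graph. *)
have /connectP[q0 q0P q0x] := remove_edge_connected exy y x'.
move: q0x; case: (shortenP q0P) => {q0P}q qP uq _ {q0} qx.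
have /first_hit[q1 [q2 [def_q q1p off]]] : has [in u :: p] (y :: q).
  by apply/hasP; exists (last y q); rewrite ?mem_last // -qx.
move: qP uq; rewrite def_q cat_path -cat_cons cat_uniq.
move=> /andP[q1P _] /andP[uq1 _].
move: q1P; rewrite path_remove_edges => /andP[q1adj /allP q1N].
(* As [u] and [v] both lie on the trail, the path avoids uv until it first hits the trail, so the
   ear lies in [H]. *)
have fp : [set u; v] \subset u :: p.
  apply/subsetP=> z; rewrite !inE => /orP[]/eqP->; rewrite ?eqxx //.
  by case/andP: tp => _ /eqP<-; have := mem_last u p; rewrite inE.
have tear : trail_to H x' (last y q1) (y :: q1).
  rewrite /trail_to /trail /walk /= Hxy eqxx andbT uniq_walk_edges // andbT.
  apply/andP; split; last by apply/negP => /q1N; rewrite inE eqxx.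
  rewrite path_remove_edges q1adj; apply/allP=> E /off; rewrite inE.
  by apply: contraNneq => ->.
have [|p' tp' sub] := trail_reroute Hsym tp x'p q1p tear.
  move=> E /=; rewrite inE => /orP[/eqP->|/off].
    by apply: contra yNp => /walk_edges_sub/subsetP; apply; apply: set22.
  by apply: contra => /walk_edges_sub.
by exists p' => //; apply: sub; rewrite !inE eqxx orbT.
Qed.

Lemma odd_circuit_odd_trail x q : trail_to H x x q -> odd (size q) ->
  exists2 p, trail_to H u v p & odd (size p).
Proof.
have Hsym : symmetric H := remove_edge_sym u v.
move=> tq oq; have [p tp xp] := trail_through x.
have /first_hit[p1 [p2 [def_p aq off1]]] : has [in x :: q] (u :: p).
  by apply/hasP; exists x; rewrite // mem_head.
move: tp; rewrite def_p trail_to_cat => /and3P[].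
set a := last u p1 in aq * => t1 t2 /hasPn dis12.
(* The search from [v] runs back along [p2] only and stops at [a] at the latest, so its edges are
   disjoint from those of [p1]. *)
have tr2 := trail_to_rev Hsym t2.
have /first_hit[p3 [p4 [def_r bq off3]]] :
    has [in x :: q] (v :: rev (belast a p2)).
  apply/hasP; exists a; rewrite //.
  by case/andP: tr2 => _ /eqP {1}<-; apply: mem_last.
move: (tr2); rewrite def_r trail_to_cat => /and3P[].
set b := last v p3 in bq * => t3 _ _.
have dis13 E : E \in walk_edges v p3 -> E \notin walk_edges u p1.
  move=> E3; apply: dis12; rewrite -(walk_edges_trail_rev t2) def_r.
  by rewrite walk_edges_cat mem_cat E3.
have tr3 := trail_to_rev Hsym t3.
(* Every edge of [p1] and [p3] has an end off the circuit, so it cannot occur in a trail [r] along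
   the circuit. *)
have glue r : trail_to H a b r ->
    {subset walk_edges a r <= walk_edges x q} ->
    trail_to H u v (p1 ++ r ++ rev (belast v p3)).
  move=> tr sub; have /eqP rb : last a r == b by case/andP: tr.
  apply: trail_to_catI t1 _ _.
    apply: trail_to_catI tr tr3 _ => E.
    rewrite (walk_edges_trail_rev t3) => /off3.
    by apply: contra => /sub/walk_edges_sub.
  move=> E; rewrite walk_edges_cat mem_cat rb (walk_edges_trail_rev t3).
  move=> /orP[/sub/walk_edges_sub sE|/dis13//].
  by apply: contraL sE => /off1.
have [q1 [q2 [def_q tq1 tq2 dq]]] := trail_to_split tq aq.
have /eqP q1a : last x q1 == a by case/andP: tq1.
have /eqP q2x : last a q2 == x by case/andP: tq2.
(* The circuit is restarted at [a], so that [b] cuts it into two arcs. *)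
have tc : trail_to H a a (q2 ++ q1).
  apply: trail_to_catI tq2 tq1 _ => E; exact: contraL (dq E).
have bc : b \in a :: q2 ++ q1.
  move: bq; rewrite def_q !inE !mem_cat => /or3P[/eqP->|->|->].
  - by have := mem_last a q2; rewrite q2x inE => /orP[->|->]; rewrite ?orbT.
  - by rewrite !orbT.
  by rewrite orbT.
have [r1 [r2 [def_c tr1 tr2' _]]] := trail_to_split tc bc.
have /eqP r1b : last a r1 == b by case/andP: tr1.
have sub_c : walk_edges a (q2 ++ q1) =i walk_edges x q.
  by move=> E; rewrite def_q !walk_edges_cat !mem_cat q1a q2x orbC.
have g1 := glue _ tr1; have g2 := glue _ (trail_to_rev Hsym tr2').
have {}g1 : trail_to H u v (p1 ++ r1 ++ rev (belast v p3)).
  by apply: g1 => E E1; rewrite -sub_c def_c walk_edges_cat mem_cat E1.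
have {}g2 : trail_to H u v (p1 ++ rev (belast b r2) ++ rev (belast v p3)).
  apply: g2 => E; rewrite (walk_edges_trail_rev tr2') => E2.
  by rewrite -sub_c def_c walk_edges_cat mem_cat r1b E2 orbT.
(* The arcs have lengths of different parity, so one of the two glued trails is odd. *)
have : odd (size r1) (+) odd (size r2).
  rewrite -oddD -size_cat -def_c size_cat addnC -size_cat.
  by rewrite -def_q.
have [o1|e1] := boolP (odd (size (p1 ++ r1 ++ rev (belast v p3)))) => o12.
  by exists (p1 ++ r1 ++ rev (belast v p3)).
exists (p1 ++ rev (belast b r2) ++ rev (belast v p3)) => //.
move: e1 o12; rewrite !size_cat !oddD !size_rev !size_belast.
by do 4!case: (odd _).
Qed.

(** Otherwise uv is the only monochromatic edge of [adj]. Counting ordered adjacent pairs gives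
    degree sum 2 + m on the side of [u] and m on the other, where m is the number of crossing edges;
    [k] divides both, hence 2. *)
Lemma coloring_separates_ends k (c : pred V) : 2 < k ->
  (forall x, k %| degree adj x) ->
  (forall x y, H x y -> c x != c y) -> c u != c v.
Proof.
move=> k3 kdeg col; apply/negP => /eqP cuv.
have [e_sym eirr] := adj_simple.
have neq_uv : u != v by apply: contraTneq adj_uv => ->; rewrite eirr.
pose A := [pred x | c x == c u].
have mono x y : adj x y -> c x = c y ->
    (x == u) && (y == v) || (x == v) && (y == u).
  move=> exy cxy; have [/eqP xyuv|xyNuv] := boolP ([set x; y] == [set u; v]).
    have nxy : x != y by apply: contraTneq exy => ->; rewrite eirr.
    have : x \in [set u; v] by rewrite -xyuv set21.
    have : y \in [set u; v] by rewrite -xyuv set22.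
    rewrite !inE => /orP[]/eqP yE /orP[]/eqP xE; move: nxy;
      by rewrite xE yE !eqxx ?orbT.
  have := col x y; rewrite /H /remove_edges /= exy inE xyNuv cxy eqxx.
  by move=> /(_ isT).
have degE x : degree adj x =
    \sum_(y | A y) (adj x y : nat) + \sum_(y | ~~ A y) (adj x y : nat).
  by rewrite /degree -sum1dep_card big_mkcond (bigID A).
have dvdA : k %| \sum_(x | A x) degree adj x by apply: dvdn_sum.
have dvdN : k %| \sum_(x | ~~ A x) degree adj x by apply: dvdn_sum.
(* The 2 counts the ordered pairs [(u, v)] and [(v, u)]. *)
have inA : \sum_(x | A x) \sum_(y | A y) (adj x y : nat) = 2.
  pose g x y : nat := ((x == u) && (y == v)) + ((x == v) && (y == u)).
  have row x y : A x -> A y ->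
      (adj x y : nat) = g x y.
    move=> /eqP cx /eqP cy; rewrite /g; have [exy|] := boolP (adj x y).
      have := mono _ _ exy (etrans cx (esym cy)).
      case: (x =P u) => [->|_] /=; first by rewrite (negPf neq_uv) orbF => ->.
      by move=> ->.
    move=> nxy; have /negPf-> : ~~ ((x == u) && (y == v)).
      by apply: contra nxy => /andP[/eqP-> /eqP->].
    have /negPf->// : ~~ ((x == v) && (y == u)).
    by apply: contra nxy => /andP[/eqP-> /eqP->]; rewrite e_sym.
  transitivity (\sum_(x | A x) \sum_(y | A y) g x y).
    by apply: eq_bigr => x Ax; apply: eq_bigr => y Ay; rewrite row.
  have one a b : A a -> A b ->
      \sum_(x | A x) \sum_(y | A y) ((x == a) && (y == b) : nat) = 1.
    move=> Aa Ab; rewrite (bigD1 a) //= [X in _ + X]big1 => [|x].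
      rewrite (bigD1 b) //= !eqxx big1 // => y /andP[_ /negPf->].
      by rewrite andbF.
    by case/andP=> _ /negPf->; rewrite big1.
  have Au : A u by rewrite /= eqxx.
  have Av : A v by rewrite /= cuv.
  rewrite -[RHS]/(1 + 1) -{1}(one u v) // -(one v u) // -big_split.
  by apply: eq_bigr => x _; rewrite -big_split.
have inN : \sum_(x | ~~ A x) \sum_(y | ~~ A y) (adj x y : nat) = 0.
  rewrite big1 // => x /= Ax; rewrite big1 // => y /= Ay.
  have [exy|//] := boolP (adj x y).
  have cxy : c x = c y by move: Ax Ay; do 3!case: (c _).
  by case/orP: (mono _ _ exy cxy) Ax => /andP[/eqP-> _]; rewrite -?cuv eqxx.
have cross : \sum_(x | A x) \sum_(y | ~~ A y) (adj x y : nat) =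
             \sum_(x | ~~ A x) \sum_(y | A y) (adj x y : nat).
  rewrite exchange_big; apply: eq_bigr => x _; apply: eq_bigr => y _.
  by rewrite e_sym.
move: dvdA dvdN; under eq_bigr => x _ do rewrite degE.
under [X in _ -> k %| X -> _]eq_bigr => x _ do rewrite degE.
rewrite !big_split /= inA inN cross addn0 => kD kN.
move: kD; rewrite dvdn_addl // => /dvdn_leq.
by rewrite (leqNgt k) k3 => /(_ isT).
Qed.

End EdgeInTwoEdgeConnected.

Theorem theorem7 (V : finType) (adj : rel V) (k : nat) :
  simple_graph adj ->
  edge_connected 2 adj ->
  3 <= k ->
  (forall v : V, k %| degree adj v) ->
  forall f : {set V}, f \in edges adj ->
    exists (x : V) (p : seq V),
      [/\ circuit adj x p, f \in walk_edges x p & ~~ odd (walk_length x p)].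
Proof.
move=> adj_simple adj_2con k3 kdeg f.
rewrite inE => /existsP[u /existsP[v /andP[adj_uv /eqP->]]].
have [e_sym eirr] := adj_simple.
pose H := remove_edges adj [set [set u; v]].
suff [p /andP[/andP[pH up] /eqP pv] op] :
    exists2 p, trail_to H u v p & odd (size p).
  move: pH; rewrite /walk path_remove_edges => /andP[padj /allP pN].
  (* The circuit starts at [v] and crosses uv first; this edge is absent from [p], a walk in [H],
     and makes the length even. *)
  exists v, (u :: p); split.
  - rewrite /circuit /trail /walk /= pv eqxx e_sym adj_uv padj up !andbT.
    by apply/negP => /pN; rewrite setUC inE eqxx.
  - by rewrite /= setUC mem_head.
  by rewrite /walk_length size_walk_edges /= op.
have Hcon : connected H := remove_edge_connected adj_2con adj_uv.
have Hsym : symmetric H := remove_edge_sym adj_simple u v.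
have [[x [p [pH px op]]]|[c col]] := odd_closed_walk_or_coloring Hsym Hcon.
  have [y [q [tq oq]]] := odd_closed_walk_circuit pH px op.
  exact: odd_circuit_odd_trail tq oq.
(* In the bipartite case any trail will do: its ends have different colours, so its length is
   odd. *)
have [p tp] := connect_trail (Hcon u v); exists p => //.
case/andP: tp => /andP[pH _] /eqP pv.
have := coloring_separates_ends adj_simple adj_uv k3 kdeg col.
by rewrite -pv (coloring_walk col pH); case: (c u); case: (odd _).
Qed.
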